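(* Let $M=(S,P,I,AP,L)$ be a finite generalized possibilistic Kripke structure and let $s_0s_1\cdots s_n$ be a finite path fragment of $M$. Then $$Po(Cyl(s_0\cdots s_n))=I(s_0)\wedge\bigwedge_{i=0}^{n-1}P(s_i,s_{i+1})\wedge r_P(s_n)\quad\text{if } n>0,$$ and $Po(Cyl(s_0))=I(s_0)\wedge r_P(s_0)$.
   Context: A generalized possibilistic Kripke structure (GPKS) is a tuple $M=(S,P,I,AP,L)$ where $S$ is a countable nonempty set of states, $P:S\times S\to[0,1]$ and $I:S\to[0,1]$ are arbitrary functions (no normalization required), $AP$ is a set of atomic propositions and $L:S\times AP\to[0,1]$. $M$ is finite if $S$ and $AP$ are finite. $\vee,\wedge$ denote supremum and infimum in $[0,1]$ (supremum of the empty set is $0$). A path of $M$ is an infinite sequence $\pi=s_0s_1s_2\cdots$ of states with $P(s_i,s_{i+1})>0$ for all $i\ge0$; $Paths(M)$ is the set of all paths. A finite path fragment is a finite sequence $s_0\cdots s_n$ ($n\ge0$) with $P(s_i,s_{i+1})>0$ for $0\le i<n$. The cylinder set of a finite path fragment $\hat\pi$ is $Cyl(\hat\pi)=\{\pi\in Paths(M)\mid \hat\pi \text{ is a finite prefix of }\pi\}$. For $\pi=s_0s_1\cdots\in Paths(M)$, $Po(\pi)=I(s_0)\wedge\bigwedge_{i\ge0}P(s_i,s_{i+1})$, and for $E\subseteq Paths(M)$, $Po(E)=\bigvee\{Po(\pi)\mid\pi\in E\}$. Finally $r_P(s)=\bigvee\{P(s,s_1)\wedge P(s_1,s_2)\wedge\cdots\mid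 s_1,s_2,\ldots\in S\}$. *)

(* Defs.v *)
From HB Require Import structures.
From mathcomp Require Import all_boot all_order all_algebra.
From mathcomp Require Import all_classical all_reals.

Set Implicit Arguments.
Unset Strict Implicit.
Unset Printing Implicit Defensive.

Import Order.TTheory GRing.Theory Num.Theory.

Local Open Scope classical_set_scope.
Local Open Scope ring_scope.

Record gpks (R : realType) := GPKS {
  state : Type;
  trans : state -> state -> R;
  init : state -> R;
  prop : Type;
  label : state -> prop -> R;
  state_countable : countable [set: state];
  state_nonempty : [set: state] !=set0;
  trans_itv : forall s t, 0 <= trans s t <= 1;
  init_itv : forall s, 0 <= init s <= 1;
  label_itv : forall s a, 0 <= label s a <= 1
}.

Definition finite_gpks (R : realType) (M : gpks R) : Prop :=
  finite_set [set: state M] /\ finite_set [set: prop M].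

Definition paths (R : realType) (M : gpks R) : set (nat -> state M) :=
  [set pi | forall i, 0 < trans (pi i) (pi i.+1)].

(* [s] stands for s_0 ... s_n; for [i : 'I_n], [widen_ord (leqnSn n) i] is the
   index i and [lift ord0 i] is the index i + 1 in ['I_n.+1]. *)
Definition path_fragment (R : realType) (M : gpks R) (n : nat)
    (s : 'I_n.+1 -> state M) : Prop :=
  forall i : 'I_n, 0 < trans (s (widen_ord (leqnSn n) i)) (s (lift ord0 i)).

Definition cyl (R : realType) (M : gpks R) (n : nat)
    (s : 'I_n.+1 -> state M) : set (nat -> state M) :=
  [set pi | paths pi /\ forall i : 'I_n.+1, pi i = s i].

(* The infimum of P(s_0,s_1), P(s_1,s_2), ...; the family is nonempty and
   bounded below by 0, so [inf] in R agrees with the infimum in [0,1]. *)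
Definition inf_trans (R : realType) (M : gpks R) (pi : nat -> state M) : R :=
  inf (range (fun i => trans (pi i) (pi i.+1))).

Definition Po_path (R : realType) (M : gpks R) (pi : nat -> state M) : R :=
  Num.min (init (pi 0%N)) (inf_trans pi).

(* [sup set0 = 0] in the library, which is also the supremum of the empty set
   in [0,1]. *)
Definition Po (R : realType) (M : gpks R) (E : set (nat -> state M)) : R :=
  sup [set Po_path pi | pi in E].

(* The supremum ranges over all state sequences starting at [s], including
   those with zero transitions. *)
Definition rP (R : realType) (M : gpks R) (s : state M) : R :=
  sup [set inf_trans pi | pi in [set pi : nat -> state M | pi 0%N = s]].

(* Main.v *)
Require Import Defs.
From HB Require Import structures.
From mathcomp Require Import all_boot all_order all_algebra.
From mathcomp Require Import all_classical all_reals.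

Import Order.TTheory GRing.Theory Num.Theory.
Local Open Scope classical_set_scope.
Local Open Scope ring_scope.

(** Deleting the first [n] states of a path through [s_0 ... s_n] leaves a
    sequence starting at [s_n], which gives [<=]. Conversely, if the right-hand
    side exceeded [Po (cyl s)], then some sequence from [s_n] would have
    possibility [> Po (cyl s) >= 0]; all its transitions would be positive, so
    appending it to [s_0 ... s_n] would give a path of the cylinder whose
    possibility is too large. *)

Section GPKS.
Context {R : realType} {M : gpks R}.
Implicit Types (pi : nat -> state M) (E : set (nat -> state M)) (c : R).

Lemma inf_trans_le pi i : inf_trans pi <= trans (pi i) (pi i.+1).
Proof.
apply: ge_inf; last by exists i.
by exists 0 => _ [j _ <-]; have /andP[] := trans_itv (pi j) (pi j.+1).
Qed.

Lemma le_inf_trans pi c :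
  (forall i, c <= trans (pi i) (pi i.+1)) -> c <= inf_trans pi.
Proof.
move=> le_c; apply: lb_le_inf => [|_ [i _ <-]]; last exact: le_c.
by exists (trans (pi 0) (pi 1)), 0.
Qed.

Lemma inf_trans_ge0 pi : 0 <= inf_trans pi.
Proof. by apply: le_inf_trans => i; have /andP[] := trans_itv (pi i) (pi i.+1). Qed.

Lemma inf_trans_le1 pi : inf_trans pi <= 1.
Proof.
by apply: le_trans (inf_trans_le pi 0) _; have /andP[] := trans_itv (pi 0) (pi 1).
Qed.

Lemma Po_path_ge0 pi : 0 <= Po_path pi.
Proof. by rewrite le_min inf_trans_ge0 andbT; have /andP[] := init_itv (pi 0). Qed.

Lemma Po_path_le_Po [E pi] : E pi -> Po_path pi <= Po E.
Proof.
move=> Epi; apply: ub_le_sup; last by exists pi.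
by exists 1 => _ [rho _ <-]; rewrite ge_min inf_trans_le1 orbT.
Qed.

(** The bound [0 <= c] takes care of an empty [E], where [Po E] is the default value [0] of
    [sup]. *)
Lemma Po_le E c : 0 <= c -> (forall pi, E pi -> Po_path pi <= c) -> Po E <= c.
Proof.
move=> c_ge0 le_c; have [->|/set0P[pi Epi]] := eqVneq E set0.
  by rewrite /Po image_set0 sup0.
by apply: ge_sup => [|_ [rho /le_c ? <-] //]; exists (Po_path pi), pi.
Qed.

Lemma Po_ge0 E : 0 <= Po E.
Proof.
have [->|/set0P[pi Epi]] := eqVneq E set0; first by rewrite /Po image_set0 sup0.
exact: le_trans (Po_path_ge0 pi) (Po_path_le_Po Epi).
Qed.

Lemma inf_trans_le_rP pi : inf_trans pi <= rP (pi 0).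
Proof.
apply: ub_le_sup; last by exists pi.
by exists 1 => _ [rho _ <-]; exact: inf_trans_le1.
Qed.

Lemma rP_ge0 (x : state M) : 0 <= rP x.
Proof. exact: le_trans (inf_trans_ge0 _) (inf_trans_le_rP (fun=> x)). Qed.

(** Approximation from below replaces attainment of the supremum; the constant sequence at [x] shows
    that the family is nonempty. *)
Lemma rP_gt [x : state M] [c] :
  c < rP x -> exists2 pi, pi 0 = x & c < inf_trans pi.
Proof.
case/sup_gt => [|_ [pi pi0 <-] lt_c]; last by exists pi.
by exists (inf_trans (fun=> x)), (fun=> x).
Qed.

Section Fragment.
Context {n : nat} (s : 'I_n.+1 -> state M).

Let big_trans : R :=
  \big[Num.min/1]_(i < n)
    trans (s (widen_ord (leqnSn n) i)) (s (lift ord0 i)).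

(** Index [n] is already read from [pi], so the two pieces fit when [pi 0 = s ord_max]. The term
    [inord k] is reached only for [k < n], where its value is [k]. *)
Definition splice pi (k : nat) : state M :=
  if (k < n)%N then s (inord k) else pi (k - n)%N.

Lemma splice_prefix [pi] (i : 'I_n.+1) : pi 0 = s ord_max -> splice pi i = s i.
Proof.
move=> pi0; rewrite /splice; case: ltnP => [_|n_le_i]; first by rewrite inord_val.
have -> : i = ord_max by apply/val_inj/anti_leq; rewrite /= n_le_i -ltnS ltn_ord.
by rewrite /= subnn.
Qed.

Lemma splice_suffix pi k : splice pi (n + k) = pi k.
Proof. by rewrite /splice ltnNge leq_addr addKn. Qed.

(** Each transition of the splice lies in one of the two pieces; at [k.+1 = n] the shared state
    [pi 0 = s ord_max] makes it the last one of [s]. The predicate [p] serves both for positivity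
    and for a lower bound. *)
Lemma splice_trans pi (p : R -> Prop) : pi 0 = s ord_max ->
  (forall i : 'I_n, p (trans (s (widen_ord (leqnSn n) i)) (s (lift ord0 i)))) ->
  (forall k, p (trans (pi k) (pi k.+1))) ->
  forall k, p (trans (splice pi k) (splice pi k.+1)).
Proof.
move=> pi0 p_s p_pi k; have [k_lt_n|n_le_k] := ltnP k n.
  have := p_s (Ordinal k_lt_n).
  by rewrite -!(splice_prefix _ pi0) /= /bump.
by rewrite -(subnKC n_le_k) -addnS !splice_suffix.
Qed.

Lemma big_trans_ge0 : 0 <= big_trans.
Proof.
by apply/bigmin_geP; split=> // i _; have /andP[] := trans_itv
  (s (widen_ord (leqnSn n) i)) (s (lift ord0 i)).
Qed.

Lemma Po_cyl_le :
  Po (cyl s) <= Num.min (Num.min (init (s ord0)) big_trans) (rP (s ord_max)).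
Proof.
apply: Po_le => [|pi [_ pi_s]].
  by rewrite !le_min big_trans_ge0 rP_ge0 !andbT; have /andP[] := init_itv (s ord0).
rewrite !le_min -!pi_s /Po_path !ge_min lexx /=; apply/andP; split.
  (* The big minimum starts from [1], so the bound must also be at most [1]. *)
  apply/orP; right; apply/bigmin_geP; split=> [|i _]; first exact: inf_trans_le1.
  rewrite -!pi_s /= /bump; exact: inf_trans_le.
apply/orP; right; pose tail k := pi (n + k)%N.
have -> : pi n = tail 0 by rewrite /tail addn0.
apply: le_trans (inf_trans_le_rP tail); apply: le_inf_trans => k.
by rewrite /tail addnS; exact: inf_trans_le.
Qed.

Lemma Po_cyl_ge : path_fragment s ->
  Num.min (Num.min (init (s ord0)) big_trans) (rP (s ord_max)) <= Po (cyl s).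
Proof.
move=> s_frag; rewrite leNgt !lt_min; apply/negP.
case/andP=> /andP[Po_lt_init Po_lt_big] /rP_gt[pi pi0 Po_lt_pi].
have pi_gt0 k : 0 < trans (pi k) (pi k.+1).
  exact: le_lt_trans (Po_ge0 _) (lt_le_trans Po_lt_pi (inf_trans_le pi k)).
have cyl_pi : cyl s (splice pi).
  split=> [|i]; last exact: splice_prefix.
  exact: (@splice_trans pi (fun x => 0 < x)).
have := Po_path_le_Po cyl_pi; apply/negP; rewrite -ltNge.
rewrite lt_min (splice_prefix ord0 pi0) Po_lt_init /=.
(* Both arguments of this minimum strictly exceed [Po (cyl s)], so the infimum along the splice
   would exceed it as well. *)
suff : Num.min big_trans (inf_trans pi) <= inf_trans (splice pi).
  by apply: lt_le_trans; rewrite lt_min Po_lt_big.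
apply: le_inf_trans; apply: (@splice_trans pi (fun x => _ <= x)) => // [i|k].
  by rewrite ge_min; apply/orP; left; exact: bigmin_le.
by rewrite ge_min inf_trans_le orbT.
Qed.

End Fragment.

End GPKS.

Theorem theorem1 (R : realType) (M : gpks R) (M_finite : finite_gpks M)
    (n : nat) (s : 'I_n.+1 -> state M) (s_frag : path_fragment s) :
  ((0 < n)%N ->
     Po (cyl s) =
       Num.min
         (Num.min (init (s ord0))
            (\big[Num.min/1]_(i < n)
               trans (s (widen_ord (leqnSn n) i)) (s (lift ord0 i))))
         (rP (s ord_max)))
  /\ (n = 0%N -> Po (cyl s) = Num.min (init (s ord0)) (rP (s ord0))).
Proof.
have Po_cyl := le_anti (introT andP (conj (Po_cyl_le s) (Po_cyl_ge s s_frag))).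
split=> // n0; rewrite Po_cyl; subst n.
(* The empty minimum is [1], absorbed because [init] is at most [1]; in ['I_1] the indices [ord_max]
   and [ord0] coincide. *)
rewrite big_ord0 (min_l (y := 1)); last by have /andP[] := init_itv (s ord0).
by congr (Num.min _ (rP (s _))); exact: val_inj.
Qed.
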